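(* Fix $q\in(0,1)$ and let $\Gamma_n=T_n$ be a tree on $k_n$ vertices ($2\le k_n\le n$). Assume that there is a constant $D<\infty$ such that the maximum degree satisfies $d_{\max}(T_n)\le D$ for all $n$. If $k_n=o(n)$, then weak detection is impossible (even under full observation, $Q_n=\binom n2$, and hence for every query budget).
   Context: Setup. Under $\mathcal H_0$, $G$ is a random graph on $[n]=\{1,\dots,n\}$ in which each pair in $\binom{[n]}{2}$ is an edge independently with probability $q$. Under $\mathcal H_1$, a copy $\Gamma_n^\star$ is drawn uniformly from the set of all subgraphs of the complete graph on $[n]$ isomorphic to $\Gamma_n$; all edges of $\Gamma_n^\star$ are in $G$, and every other pair is an edge independently with probability $q$. For a query set $\mathcal Q\subseteq\binom{[n]}{2}$ (chosen non-adaptively), the transcript is $G_{\mathcal Q}=(\mathbf 1\{e\in e(G)\})_{e\in\mathcal Q}$, with laws $\mathbb P_{\mathcal H_0,\mathcal Q}$, $\mathbb P_{\mathcal H_1,\mathcal Q}$. The optimal risk under budget $Q_n$ is $R^\star_{n,Q_n}=1-\sup_{|\mathcal Q|\le Q_n} d_{\mathrm{TV}}(\mathbb P_{\mathcal H_1,\mathcal Q},\mathbb P_{\mathcal H_0,\mathcal Q})$. Weak detection is impossible with budget $Q_n$ if $\lim_nR^\star_{n,Q_n}=1$. *)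

(* Defs.v *)
From mathcomp Require Import all_boot all_order all_algebra.
From mathcomp Require Import all_classical all_reals all_analysis.

Set Implicit Arguments.
Unset Strict Implicit.
Unset Printing Implicit Defensive.

Import Order.TTheory GRing.Theory Num.Theory.
Import numFieldNormedType.Exports.

Local Open Scope classical_set_scope.
Local Open Scope ring_scope.

Notation edge V := {e : {set V} | #|e| == 2%N}.

(* A simple graph with vertex set V is identified with its edge set. *)
Notation graph V := {set edge V}.

Section Graphs.
Variable V : finType.
Implicit Type G : graph V.

Definition adj G : rel V := fun u v => [exists e in G, val e == [set u; v]%SET].

Definition degree G (v : V) : nat := #|[set e in G | v \in val e]%SET|.

Definition max_degree G : nat := \max_(v : V) degree G v.

Definition connected_graph G : Prop :=
  (0 < #|V|)%N /\ forall u v : V, connect (adj G) u v.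

(* A graph cycle is a duplicate-free closed walk on at least three vertices;
   u, v, u along a single edge is not one. *)
Definition acyclic_graph G : Prop :=
  forall c : seq V, uniq c -> cycle (adj G) c -> (size c <= 2)%N.

Definition tree G : Prop := connected_graph G /\ acyclic_graph G.

End Graphs.

Section PlantedModel.
Variables (R : realType) (q : R) (n : nat).

(* Subgraphs of the complete graph on [n] carry their own vertex set, so they
   are pairs (vertices, edges); (W, E) is a copy of Gamma when some injection f
   is an isomorphism from Gamma onto (W, E). *)
Definition is_copy (V : finType) (Gamma : graph V)
    (S : {set 'I_n} * graph 'I_n) : bool :=
  [exists f : {ffun V -> 'I_n},
    [&& injectiveb f, S.1 == [set f v | v in V]%SET &
        [forall e : edge 'I_n,
          (e \in S.2) == [exists e' in Gamma, val e == (f @: val e')%SET]]]].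

Definition copies (V : finType) (Gamma : graph V) :
    {set {set 'I_n} * graph 'I_n} :=
  [set S | is_copy Gamma S]%SET.

Definition bernoulli_weight (b : bool) : R := if b then q else 1 - q.

Definition null_pmf (G : graph 'I_n) : R :=
  \prod_(e : edge 'I_n) bernoulli_weight (e \in G).

(* Law of the graph given that the planted copy has edge set E. *)
Definition planted_pmf (E G : graph 'I_n) : R :=
  \prod_(e : edge 'I_n)
    (if e \in E then (e \in G)%:R else bernoulli_weight (e \in G)).

Definition alt_pmf (V : finType) (Gamma : graph V)
    (G : graph 'I_n) : R :=
  #|copies Gamma|%:R^-1 * \sum_(S in copies Gamma) planted_pmf S.2 G.

Definition transcript_type (Q : graph 'I_n) : finType :=
  {ffun {e : edge 'I_n | e \in Q} -> bool}.

Definition transcript (Q G : graph 'I_n) : transcript_type Q :=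
  [ffun e => val e \in G].

Definition transcript_law (P : graph 'I_n -> R) (Q : graph 'I_n)
    (t : transcript_type Q) : R :=
  \sum_(G : graph 'I_n | transcript Q G == t) P G.

End PlantedModel.

Definition dTV (R : realType) (X : finType) (P P' : X -> R) : R :=
  sup [set `|\sum_(x in A) P x - \sum_(x in A) P' x| | A in [set: {set X}]].

Definition optimal_risk (R : realType) (q : R) (n : nat) (V : finType)
    (Gamma : graph V) (budget : nat) : R :=
  1 - sup [set dTV (transcript_law (alt_pmf q Gamma) (Q := Q))
                   (transcript_law (null_pmf q (n := n)) (Q := Q))
          | Q in [set Q : graph 'I_n | (#|Q| <= budget)%N]].

Definition weak_detection_impossible (R : realType) (q : R) (k : nat -> nat)
    (Gamma : forall n, graph 'I_(k n)) (budget : nat -> nat) : Prop :=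
  optimal_risk q n (Gamma n) (budget n) @[n --> \oo] --> (1 : R).

(* Main.v *)
(* Second moment method. The chi-square divergence between the planted and the
   null law is E[q^{-X}] - 1, where X is the number of edges shared by two
   independent uniform copies of the tree; it dominates the squared total
   variation distance of every transcript. Fix one copy and move the other by a
   uniform permutation s. List the vertices so that each has at most one earlier
   neighbour, which is possible in an acyclic graph. When s(v) is exposed after
   its predecessors, it is uniform on the unused points, so it creates a shared
   edge with probability at most D / (n - k). Hence
   E[q^{-X}] <= (1 + (1/q - 1) D / (n - k))^k, which tends to 1 if k = o(n). *)
Require Import Defs.
From mathcomp Require Import all_boot all_order all_algebra all_fingroup.
From mathcomp Require Import all_classical all_reals all_analysis.
From mathcomp Require Import ring lra.

Set Implicit Arguments.
Unset Strict Implicit.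
Unset Printing Implicit Defensive.

Import Order.TTheory GRing.Theory Num.Theory.
Import numFieldNormedType.Exports.

Local Open Scope ring_scope.

(** * Neighbours, paths and degeneracy of acyclic graphs *)

Section GraphFacts.
Variable V : finType.
Implicit Types (G : graph V) (A : {set V}).

Lemma adj_sym G : symmetric (adj G).
Proof. by move=> u v; rewrite /adj finset.setUC. Qed.

Lemma mem_adj G (e : edge V) u v :
  val e = [set u; v]%SET -> (e \in G) = adj G u v.
Proof.
move=> he; apply/idP/existsP => [eG|[e' /andP[e'G /eqP he']]].
  by exists e; rewrite eG he eqxx.
by rewrite (_ : e = e') //; apply: val_inj; rewrite he he'.
Qed.

Lemma edge_pair (e : edge V) x :
  x \in val e -> exists2 y, y != x & val e = [set x; y]%SET.
Proof.
have /cards2P[a [b [ab ->]]] := valP e.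
rewrite !inE => /orP[]/eqP->; first by exists b => //; rewrite eq_sym.
by exists a => //; rewrite finset.setUC.
Qed.

Lemma card_adj_le_degree G x : (#|[set y | adj G x y]%SET| <= degree G x)%N.
Proof.
(* Sends a neighbour [y] to the edge joining it to [x]. Values are vertex sets because [edge V] may
   be empty; the default is never reached at a neighbour. *)
pose f y := odflt [set x]%SET (omap val
  [pick e : edge V | (e \in G) && (val e == [set x; y]%SET)]).
have fE y : adj G x y -> exists e : edge V,
    [/\ e \in G, val e = [set x; y]%SET & f y = val e].
  rewrite /f; case: pickP => [e /andP[eG /eqP he] _|h /existsP[e]].
    by exists e.
  by rewrite h.
rewrite /degree -(card_imset [set e in G | _]%SET val_inj).
rewrite -(card_in_imset (f := f)).
  apply/subset_leq_card/fintype.subsetP => _ /imsetP[y + ->].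
  rewrite inE => /fE[e [eG he ->]].
  by apply: imset_f; rewrite inE eG he !inE eqxx.
move=> y z; rewrite !inE => /fE[e [_ he ->]] /fE[e' [_ he' ->]] ee'.
have yz : [set x; y]%SET = [set x; z]%SET by rewrite -he -he' ee'.
have nx w (d : edge V) : val d = [set x; w]%SET -> w != x.
  move=> hd; have := valP d; rewrite /= hd cards2.
  by case: (w =P x) => // ->; rewrite eqxx.
have : y \in [set x; z]%SET by rewrite -yz !inE eqxx orbT.
by rewrite !inE (negbTE (nx _ _ he)) => /eqP.
Qed.

Lemma degree_le_max G x : (degree G x <= max_degree G)%N.
Proof. exact: (leq_bigmax x). Qed.

(** The path from [x] to [y], closed by the edge back to [x], is a cycle without repetition, so it
    has only two vertices. *)
Lemma acyclic_path_closing G x p y : acyclic_graph G ->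
  uniq (x :: p) -> path (adj G) x p -> y \in p -> adj G y x -> y = head x p.
Proof.
move=> acG + + yp; case/splitPr: yp => p1 p2.
rewrite -cat_cons cat_uniq => /and3P[u1 u2 _].
rewrite cat_path => /andP[pth1 /= /andP[pth2 _]] yx.
have := acG (rcons (x :: p1) y).
rewrite rcons_uniq u1 andbT.
have -> : y \notin x :: p1.
  by apply/negP => yin; move/hasP: u2; apply; exists y; rewrite ?inE ?eqxx.
rewrite /= !rcons_path last_rcons pth1 pth2 yx => /(_ isT isT).
by case: p1 {pth1 pth2 u1 u2} => //= a p1; rewrite size_rcons.
Qed.

(* The starting point of a longest path inside A has degree at most one in A. *)
Lemma acyclic_degenerate G A : acyclic_graph G -> A != finset.set0 ->
  exists2 v, v \in A &
    (#|[set e in G | (v \in val e) && (val e \subset A)]%SET| <= 1)%N.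
Proof.
move=> acG /set0Pn[x0 x0A]; apply: contrapT => noV.
(* If every vertex of [A] has two edges inside [A], paths in [A] extend to every length; one with
   [#|V|] edges already has too many distinct vertices. *)
suff /(_ #|V|)[x [p [u _ _ sz]]] : forall m, exists x p,
    [/\ uniq (x :: p), all [in A] (x :: p), path (adj G) x p & size p = m].
  have := card_uniqP u; have := max_card [in x :: p].
  by rewrite /= sz => /[swap] ->; rewrite ltnn.
elim=> [|m [x [p [u Ap pth sz]]]]; first by exists x0, [::]; rewrite /= x0A.
have xA : x \in A by case/andP: Ap.
have /card_gt1P[e1 [e2 [e1P e2P e12]]] :
    (1 < #|[set e in G | (x \in val e) && (val e \subset A)]%SET|)%N.
  by rewrite ltnNge; apply/negP => le1; apply: noV; exists x.
have nbr e : e \in [set e in G | (x \in val e) && (val e \subset A)]%SET ->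
    exists y, [/\ val e = [set x; y]%SET, y != x, y \in A & adj G y x].
  rewrite inE => /and3P[eG /edge_pair[y yx he] /fintype.subsetP eA].
  exists y; split=> //; first by apply: eA; rewrite he !inE eqxx orbT.
  by rewrite adj_sym -(mem_adj _ he).
have [y1 [he1 y1x y1A a1]] := nbr _ e1P.
have [y2 [he2 y2x y2A a2]] := nbr _ e2P.
have ext y : y \in A -> adj G y x -> y != x -> y \notin p -> exists x p,
    [/\ uniq (x :: p), all [in A] (x :: p), path (adj G) x p & size p = m.+1].
  move=> yA yx ynx yp; exists y, (x :: p).
  rewrite /= in u Ap *; rewrite yA Ap yx pth sz inE negb_or ynx yp; split=> //.
have [y1p|] := boolP (y1 \in p); last exact: ext.
have [y2p|] := boolP (y2 \in p); last exact: ext.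
(* If both neighbours lay on the path, both would be its second vertex, and the two edges would
   coincide. *)
case/eqP: e12; apply: val_inj; rewrite he1 he2.
rewrite (acyclic_path_closing acG u pth y1p a1).
by rewrite (acyclic_path_closing acG u pth y2p a2).
Qed.

End GraphFacts.

(** * Transport of edges along an injection *)

Section EdgeMap.
Variables (V W : finType) (f : V -> W) (injf : injective f).

Fact edge_map_subproof (e : edge V) : #|f @: val e| == 2%N.
Proof. by rewrite card_imset // (valP e). Qed.

Definition edge_map (e : edge V) : edge W := Sub (f @: val e) (edge_map_subproof e).

Lemma edge_map_inj : injective edge_map.
Proof. by move=> d e /(congr1 val) /(imset_inj injf)/val_inj. Qed.

Lemma max_degree_edge_map (G : graph V) :
  (max_degree (edge_map @: G) <= max_degree G)%N.
Proof.
apply/bigmax_leqP => x _.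
have [/codomP[v ->]|xf] := boolP (x \in codom f).
  apply: leq_trans (degree_le_max G v); rewrite /degree.
  rewrite -(card_imset [set e in G | _]%SET edge_map_inj).
  apply/subset_leq_card/fintype.subsetP => e.
  rewrite inE => /andP[/imsetP[d dG ->]]; rewrite /= mem_imset // => vd.
  by apply: imset_f; rewrite inE dG.
rewrite /degree (_ : [set _ in _ | _]%SET = finset.set0) ?cards0 //.
apply/finset.setP => e; rewrite !inE; apply/negP => /andP[/imsetP[d _ ->]] /=.
by case/imsetP => v _ xE; rewrite xE codom_f in xf.
Qed.

End EdgeMap.

(** * Overlap of a randomly permuted acyclic graph with a fixed graph *)

Section RandomOverlap.
Variables (R : realFieldType) (V W : finType) (f : V -> W) (injf : injective f).
Variables (G : graph V) (H : graph W) (lam : R) (D : nat).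
Hypotheses (lam_ge1 : 1 <= lam) (degH : (max_degree H <= D)%N).
Implicit Types (A : {set V}) (s : {perm W}).

Definition place s : edge V -> edge W := edge_map (inj_comp (@perm_inj _ s) injf).

(** The power of [lam] counting the edges of [G] inside [A] that land in [H]. The product form
    factors when a vertex joins [A]. *)
Definition overlap_weight A s : R :=
  \prod_(e in G | val e \subset A) (if place s e \in H then lam else 1).

Lemma overlap_weight_ge0 A s : 0 <= overlap_weight A s.
Proof.
by apply: prodr_ge0 => e _; case: ifP => // _; rewrite (le_trans _ lam_ge1).
Qed.

Lemma overlap_weight_stable A s (t : {perm W}) :
  {in A, forall x, t (f x) = f x} -> overlap_weight A (t * s)%g = overlap_weight A s.
Proof.
move=> tf; apply: eq_bigr => e /andP[_ /fintype.subsetP eA].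
suff -> : place (t * s)%g e = place s e by [].
by apply: val_inj; apply: eq_in_imset => x /eA xA; rewrite /= permM tf.
Qed.

(* Composing with a transposition of [f v] and any [z] outside [f @: A] leaves
   the weight of A unchanged, so [s (f v)] is uniform on the unused points. *)
Lemma resample A u v : u \in A -> v \notin A ->
  (#|W| - #|A|)%:R * (\sum_s overlap_weight A s * (adj H (s (f u)) (s (f v)))%:R)
  <= D%:R * \sum_s overlap_weight A s.
Proof.
move=> uA vA; pose Z := (~: (f @: A))%SET.
have cZ : #|Z| = (#|W| - #|A|)%N.
  by rewrite /Z -(card_imset A injf) -[#|W|](cardsC (f @: A)) addKn.
have swap z : z \in Z ->
    \sum_s overlap_weight A s * (adj H (s (f u)) (s (f v)))%:R =
    \sum_s overlap_weight A s * (adj H (s (f u)) (s z))%:R.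
  rewrite inE => zA; rewrite (reindex_inj (mulgI (tperm (f v) z))) /=.
  have fixA x : x \in A -> tperm (f v) z (f x) = f x.
    move=> xA; rewrite tpermD //.
      by rewrite (inj_eq injf); apply: contraNneq vA => ->.
    by apply: contraNneq zA => ->; rewrite imset_f.
  by apply: eq_bigr => s _; rewrite overlap_weight_stable // !permM fixA // tpermL.
(* Sum the identity [swap] over [z] in [Z] and exchange the sums: for each [s], at most [D] points
   [z] have [s z] adjacent to [s (f u)]. *)
rewrite -cZ mulr_natl -sumr_const (eq_bigr _ swap) exchange_big mulr_sumr /=.
apply: ler_sum => s _; rewrite -mulr_sumr mulrC ler_wpM2r ?overlap_weight_ge0 //.
rewrite -natr_sum ler_nat.
apply: leq_trans (leq_trans (degree_le_max H (s (f u))) degH).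
apply: leq_trans (card_adj_le_degree _ _).
rewrite -big_mkcondr sum1_card -(card_imset _ (@perm_inj _ s)).
by apply/subset_leq_card/fintype.subsetP => _ /imsetP[z /andP[_ zP] ->]; rewrite inE.
Qed.

(** Cost of exposing one vertex. Using [#|V|] in place of [#|A|] makes the factor the same at every
    step. *)
Let rho := 1 + (lam - 1) * (D%:R / (#|W| - #|V|)%:R).

(** At most one new edge appears, joining [v] to some [u] in [A]. Its factor is 1 plus [lam - 1]
    times the indicator of adjacency in [H], and [resample] bounds the weighted sum of that
    indicator. *)
Lemma overlap_step A v : (#|V| < #|W|)%N -> v \notin A ->
  (#|[set e in G | (v \in val e) && (val e \subset v |: A)]%SET| <= 1)%N ->
  \sum_s overlap_weight (v |: A) s <= rho * \sum_s overlap_weight A s.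
Proof.
move=> VW vA; set E := finset _ => E1.
have S0 : 0 <= \sum_s overlap_weight A s.
  by apply: sumr_ge0 => s _; exact: overlap_weight_ge0.
have N0 : 0 < (#|W| - #|V|)%:R :> R by rewrite ltr0n subn_gt0.
have lam1 : 0 <= lam - 1 by rewrite subr_ge0.
have split s : overlap_weight (v |: A) s =
    overlap_weight A s * \prod_(e in E) (if place s e \in H then lam else 1).
  rewrite /overlap_weight (bigID (fun e : edge V => v \notin val e)) /=; congr (_ * _).
    apply: eq_bigl => e; rewrite -andbA; congr (_ && _).
    by rewrite -finset.subsetD1 finset.setU1K.
  by apply: eq_bigl => e; rewrite !inE negbK -andbA; congr (_ && _); rewrite andbC.
rewrite (eq_bigr _ (fun s _ => split s)).
move: E1; rewrite leq_eqVlt ltnS leqn0 cards_eq0.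
case/orP=> [/cards1P[e Ee]|/eqP->]; last first.
  under eq_bigr do rewrite big_set0 mulr1.
  rewrite -[leLHS]mul1r ler_wpM2r // lerDl mulr_ge0 // divr_ge0 //.
have : e \in E by rewrite Ee inE.
rewrite inE => /and3P[eG /edge_pair[u uv he] /fintype.subsetP eA].
have uA : u \in A.
  by have := eA u; rewrite he !inE eqxx orbT (negbTE uv) => /(_ isT).
have := resample uA vA.
set T := \sum_s _ * _; rewrite -ler_pdivlMl; last first.
  rewrite ltr0n subn_gt0 (leq_ltn_trans _ VW) //.
  by apply: max_card.
move=> hT.
have -> : \sum_s overlap_weight A s *
     \prod_(e0 in E) (if place s e0 \in H then lam else 1) =
   \sum_s overlap_weight A s + (lam - 1) * T.
  rewrite mulr_sumr -big_split; apply: eq_bigr => s _ /=.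
  rewrite Ee big_set1 (@mem_adj _ H _ (s (f u)) (s (f v))).
    by case: adj; rewrite ?mulr1 ?mulr0 ?addr0 //; ring.
  by rewrite /= he finset.setUC imsetU1 imset_set1.
rewrite /rho (mulrDl 1) mul1r lerD2l -mulrA ler_wpM2l // (le_trans hT) //.
rewrite mulrA ler_wpM2r // mulrC ler_wpM2l //.
rewrite lef_pV2 ?posrE // ?ler_nat ?leq_sub2l ?max_card //.
by rewrite ltr0n subn_gt0 (leq_ltn_trans _ VW) // max_card.
Qed.

(** Induction on [#|A|]: remove a vertex with at most one edge inside [A], and pay a factor [rho]
    for it. *)
Lemma overlap_bound : (#|V| < #|W|)%N -> acyclic_graph G ->
  \sum_s \prod_(e in G) (if place s e \in H then lam else 1)
  <= #|{perm W}|%:R * rho ^+ #|V|.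
Proof.
move=> VW acG.
suff bound m A : #|A| = m ->
    \sum_s overlap_weight A s <= #|{perm W}|%:R * rho ^+ m.
  rewrite -(cardsT V); apply: le_trans (bound _ _ erefl).
  rewrite le_eqVlt; apply/orP; left; apply/eqP/eq_bigr => s _.
  by apply: eq_bigl => e; rewrite finset.subsetT andbT.
have rho0 : 0 <= rho.
  by rewrite addr_ge0 // mulr_ge0 ?subr_ge0 // divr_ge0.
elim: m A => [|m IH] A cA.
  rewrite expr0 mulr1 -sum1_card natr_sum; apply: ler_sum => s _.
  rewrite /overlap_weight big1 // => e /andP[_].
  rewrite (cards0_eq cA) finset.subset0 => /eqP e0.
  by have := valP e; rewrite /= e0 cards0.
have [|v vA E1] := acyclic_degenerate acG (A := A); first by rewrite -card_gt0 cA.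
have := @overlap_step (A :\ v) v VW.
rewrite finset.setD1K // !inE eqxx => /(_ isT E1) /le_trans->//.
rewrite exprS mulrCA ler_wpM2l // IH //.
by have := cardsD1 v A; rewrite vA cA => -[].
Qed.

End RandomOverlap.

(** * Averaging over copies by permuting the vertices *)

Section Copies.
Variables (n : nat) (V : finType) (Gamma : graph V).

Lemma copiesP (S : {set 'I_n} * graph 'I_n) :
  reflect (exists (f : V -> 'I_n) (injf : injective f),
             S = ((f @: V)%SET, (edge_map injf @: Gamma)%SET))
          (S \in copies n Gamma).
Proof.
rewrite inE; apply: (iffP existsP) => [[f /and3P[/injectiveP injf /eqP S1 /forallP S2]]|].
  exists f, injf; rewrite [S]surjective_pairing S1; congr pair.
  apply/finset.setP => e; rewrite (eqP (S2 e)); apply/existsP/imsetP.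
    by case=> d /andP[dG /eqP ed]; exists d => //; exact: val_inj.
  by case=> d dG ->; exists d; rewrite dG /=.
case=> f [injf ->]; exists (finfun f) => /=.
have fE : finfun f =1 f by exact: ffunE.
apply/and3P; split; first by apply/injectiveP => x y; rewrite !fE => /injf.
  by apply/eqP/eq_imset => x; rewrite fE.
apply/forallP => e; apply/eqP; apply/imsetP/existsP.
  by case=> d dG ->; exists d; rewrite dG; apply/eqP/eq_imset => x; rewrite fE.
case=> d /andP[dG /eqP ed]; exists d => //; apply: val_inj; apply: (etrans ed).
exact: eq_imset.
Qed.

Lemma copies_neq0 : (#|V| <= n)%N -> (0 < #|copies n Gamma|)%N.
Proof.
move=> kn; pose f x := widen_ord kn (enum_rank x).
have injf : injective f by move=> x y [/val_inj/enum_rank_inj].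
apply/card_gt0P; exists ((f @: V)%SET, (edge_map injf @: Gamma)%SET).
by apply/copiesP; exists f, injf.
Qed.

Definition perm_copy (s : {perm 'I_n}) (S : {set 'I_n} * graph 'I_n) :=
  ((s @: S.1)%SET, (edge_map (@perm_inj _ s) @: S.2)%SET).

Lemma perm_copy_inj s : injective (perm_copy s).
Proof.
move=> [A E] [B F] [] /(imset_inj (@perm_inj _ s)) -> .
by move=> /(imset_inj (edge_map_inj (injf := @perm_inj _ s))) ->.
Qed.

Lemma edge_map_perm (f : V -> 'I_n) (injf : injective f) (s : {perm 'I_n}) :
  (edge_map (@perm_inj _ s) @: (edge_map injf @: Gamma))%SET =
  (place injf s @: Gamma)%SET.
Proof.
rewrite -imset_comp; apply: eq_imset => e; apply: val_inj => /=.
exact/esym/imset_comp.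
Qed.

Lemma perm_copy_copies s S : S \in copies n Gamma -> perm_copy s S \in copies n Gamma.
Proof.
case/copiesP=> f [injf ->]; apply/copiesP.
exists (s \o f), (inj_comp (@perm_inj _ s) injf).
by rewrite /perm_copy /= edge_map_perm -imset_comp.
Qed.

Variable (R : realFieldType).

(** Each permutation acts bijectively on the copies, so the sum of [F] is unchanged by the action.
    Averaging over [s] reduces the claim to a single copy moved by a uniform permutation. *)
Lemma copies_average (F : {set 'I_n} * graph 'I_n -> R) (B : R) :
  (forall S, S \in copies n Gamma ->
     \sum_s F (perm_copy s S) <= #|{perm 'I_n}|%:R * B) ->
  \sum_(S in copies n Gamma) F S <= #|copies n Gamma|%:R * B.
Proof.
move=> FB; have P0 : 0 < #|{perm 'I_n}|%:R :> R.
  by rewrite ltr0n; apply/card_gt0P; exists 1%g.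
have perm_sum s : \sum_(S in copies n Gamma) F S =
    \sum_(S in copies n Gamma) F (perm_copy s S).
  rewrite -(big_imset _ (in2W (@perm_copy_inj s))); apply: eq_bigl => S.
  suff -> : (perm_copy s @: copies n Gamma)%SET = copies n Gamma by [].
  apply/eqP; rewrite eqEcard card_imset ?leqnn ?andbT; last exact: perm_copy_inj.
  by apply/fintype.subsetP => _ /imsetP[T TC ->]; exact: perm_copy_copies.
rewrite -(ler_pM2l P0) mulrCA mulr_natl -sumr_const.
rewrite (eq_bigr _ (fun s _ => perm_sum s)) exchange_big /= mulr_natl -sumr_const.
exact: ler_sum.
Qed.

Lemma exp_card_setI (E H : graph 'I_n) (lam : R) :
  lam ^+ #|E :&: H|%SET = \prod_(e in E) (if e \in H then lam else 1).
Proof.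
by rewrite -big_mkcondr -prodr_const; apply: eq_bigl => e; rewrite inE.
Qed.

Lemma copies_overlap (lam : R) (D : nat) S' :
  1 <= lam -> (#|V| < n)%N -> acyclic_graph Gamma -> (max_degree Gamma <= D)%N ->
  S' \in copies n Gamma ->
  \sum_(S in copies n Gamma) lam ^+ #|S.2 :&: S'.2|%SET <=
  #|copies n Gamma|%:R * (1 + (lam - 1) * (D%:R / (n - #|V|)%:R)) ^+ #|V|.
Proof.
move=> lam1 Vn acG degG /copiesP[g [injg ->]] /=.
apply: copies_average => _ /copiesP[f [injf ->]] /=.
rewrite (eq_bigr (fun s : {perm 'I_n} => \prod_(e in Gamma)
    (if place injf s e \in (edge_map injg @: Gamma)%SET then lam else 1))); last first.
  move=> s _; rewrite edge_map_perm exp_card_setI big_imset //.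
  by move=> d e _ _; exact: edge_map_inj.
have := @overlap_bound R _ _ f injf Gamma (edge_map injg @: Gamma)%SET lam D lam1.
by rewrite card_ord; apply=> //; apply: leq_trans degG; exact: max_degree_edge_map.
Qed.

End Copies.

(** * The chi-square divergence of the planted law *)

Section SecondMoment.
Variables (R : realType) (q : R) (n : nat).
Hypotheses (hq0 : 0 < q) (hq1 : q < 1).

(** Distributivity: a graph is an independent choice of presence or absence for each edge. *)
Lemma sum_prod_graph (g : edge 'I_n -> bool -> R) :
  \sum_(G : graph 'I_n) \prod_e g e (e \in G) = \prod_e (g e true + g e false).
Proof.
rewrite bigA_distr; apply: eq_big => // G _; apply: eq_bigr => e _.
by case: (e \in G).
Qed.

Lemma null_pmf_gt0 (G : graph 'I_n) : 0 < null_pmf q G.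
Proof.
apply: prodr_gt0 => e _; rewrite /bernoulli_weight.
by case: ifP => // _; rewrite subr_gt0.
Qed.

Lemma sum_null_pmf : \sum_(G : graph 'I_n) null_pmf q G = 1.
Proof.
rewrite (sum_prod_graph (fun _ => bernoulli_weight q)) big1 // => e _.
by rewrite /bernoulli_weight; ring.
Qed.

Lemma sum_planted_pmf (E : graph 'I_n) : \sum_(G : graph 'I_n) planted_pmf q E G = 1.
Proof.
rewrite (sum_prod_graph (fun e (b : bool) =>
  if e \in E then b%:R else bernoulli_weight q b)).
by rewrite big1 // => e _; case: ifP => _; rewrite /bernoulli_weight /=; ring.
Qed.

(** The sum factors over edges. An edge in both [E] and [F] contributes [q^-1]; every other edge
    contributes 1. *)
Lemma planted_pair (E F : graph 'I_n) :
  \sum_(G : graph 'I_n) planted_pmf q E G * planted_pmf q F G / null_pmf q G =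
  q^-1 ^+ #|E :&: F|%SET.
Proof.
pose w (A : graph 'I_n) e (b : bool) := if e \in A then b%:R else bernoulli_weight q b.
pose g e b := w E e b * w F e b / bernoulli_weight q b.
rewrite (eq_bigr (fun G : graph 'I_n => \prod_e g e (e \in G))); last first.
  by move=> G _; rewrite /g 2!big_split prodfV.
rewrite sum_prod_graph exp_card_setI [RHS]big_mkcond; apply: eq_bigr => e _.
have q0 : q != 0 by rewrite gt_eqF.
have q1 : 1 - q != 0 by rewrite subr_eq0 gt_eqF.
rewrite /g /w /bernoulli_weight.
by case: (e \in E); case: (e \in F) => /=; field; rewrite ?q0 ?q1.
Qed.

Variables (V : finType) (Gamma : graph V).
Hypothesis Vn : (#|V| <= n)%N.

Let N : R := #|copies n Gamma|%:R.

Let N_neq0 : N != 0.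
Proof. by rewrite pnatr_eq0 -lt0n copies_neq0. Qed.

Lemma sum_alt_pmf : \sum_(G : graph 'I_n) alt_pmf q Gamma G = 1.
Proof.
rewrite -mulr_sumr exchange_big /= (eq_bigr (fun=> 1)); last first.
  by move=> S _; exact: sum_planted_pmf.
by rewrite sumr_const mulVf.
Qed.

(** Expanding the square leaves the second moment of the likelihood ratio minus 1; as the
    alternative is a mixture over copies, that moment is a double sum of [planted_pair] terms. *)
Lemma alt_chi2 :
  \sum_(G : graph 'I_n) (alt_pmf q Gamma G - null_pmf q G) ^+ 2 / null_pmf q G =
  N^-1 ^+ 2 * (\sum_(S' in copies n Gamma) \sum_(S in copies n Gamma)
    q^-1 ^+ #|S.2 :&: S'.2|%SET) - 1.
Proof.
transitivity (\sum_(G : graph 'I_n) (alt_pmf q Gamma G ^+ 2 / null_pmf q G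
                 - 2 * alt_pmf q Gamma G + null_pmf q G)).
  by apply: eq_bigr => G _; field; rewrite gt_eqF // null_pmf_gt0.
rewrite big_split sumrB -mulr_sumr sum_alt_pmf sum_null_pmf /=.
rewrite (_ : forall x : R, x - 2 * 1 + 1 = x - 1); last by move=> x; ring.
congr (_ - _); rewrite mulr_sumr.
rewrite (eq_bigr (fun S' => \sum_(G : graph 'I_n) \sum_(S in copies n Gamma)
   N^-1 ^+ 2 * (planted_pmf q S.2 G * planted_pmf q S'.2 G / null_pmf q G))); last first.
  move=> S' _; rewrite exchange_big mulr_sumr /=; apply: eq_bigr => S _.
  by rewrite -mulr_sumr planted_pair.
rewrite exchange_big; apply: eq_bigr => G _ /=.
rewrite /alt_pmf exprMn -/N -mulrA [X in _ * (X / _)]expr2 big_distrlr /=.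
rewrite exchange_big mulr_suml mulr_sumr /=.
apply: eq_bigr => S _; rewrite mulr_suml mulr_sumr; apply: eq_bigr => S' _.
by rewrite !mulrA.
Qed.

End SecondMoment.

(** * From chi-square to total variation and risk *)

(** The Cauchy-Schwarz bound, obtained without square roots from a pointwise AM-GM inequality with
    weight [eps]. *)
Lemma l1_le_chi2 (R : realFieldType) (X : finType) (p0 p1 : X -> R) (eps : R) :
  (forall x, 0 < p0 x) -> \sum_x p0 x = 1 -> 0 < eps ->
  \sum_x (p1 x - p0 x) ^+ 2 / p0 x <= eps ^+ 2 ->
  \sum_x `|p1 x - p0 x| <= eps.
Proof.
move=> p0_gt0 p0_sum eps0 chi2.
(* AM-GM: [2 |d| <= eps p + d^2 / (p eps)] *)
have amgm x : `|p1 x - p0 x| <=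
    2^-1 * (eps * p0 x + eps^-1 * ((p1 x - p0 x) ^+ 2 / p0 x)).
  have p0x := p0_gt0 x; rewrite -[(p1 x - p0 x) ^+ 2]real_normK ?num_real //.
  set d := `|_|.
  have ep : 0 < eps * p0 x by rewrite mulr_gt0.
  rewrite -subr_ge0 (_ : _ - d = (eps * p0 x - d) ^+ 2 / (2 * (eps * p0 x))).
    by rewrite divr_ge0 ?sqr_ge0 // mulr_ge0 // ltW.
  by field; rewrite !gt_eqF.
apply: le_trans (ler_sum _ (fun x _ => amgm x)) _.
rewrite -mulr_sumr big_split -!mulr_sumr p0_sum mulr1 /=.
rewrite mulrC ler_pdivrMr // mulr_natr mulr2n lerD2l.
by rewrite mulrC ler_pdivrMr // -expr2.
Qed.

Lemma sum_transcript_law (R : realType) n (P : graph 'I_n -> R) (Q : graph 'I_n)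
    (A : {set transcript_type Q}) :
  \sum_(t in A) transcript_law P t = \sum_(G | transcript Q G \in A) P G.
Proof.
rewrite [RHS](partition_big (transcript Q) [in A]) //=; apply: eq_bigr => t tA.
by apply: eq_bigl => G; case: eqP => [->|]; rewrite ?tA ?andbF.
Qed.

(** An event on transcripts pulls back to an event on graphs, so observing less cannot increase the
    distance. The empty event gives the lower bound. *)
Lemma dTV_transcript_le (R : realType) n (P1 P0 : graph 'I_n -> R)
    (Q : graph 'I_n) (eps : R) :
  \sum_G `|P1 G - P0 G| <= eps ->
  0 <= dTV (transcript_law P1 (Q := Q)) (transcript_law P0 (Q := Q)) <= eps.
Proof.
move=> l1; rewrite /dTV; set E := image _ _.
have ubE : ubound E eps.
  move=> _ [A _ <-]; rewrite !sum_transcript_law -sumrB.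
  apply: le_trans (ler_norm_sum _ _ _) (le_trans _ l1).
  by rewrite big_mkcond ler_sum // => G _; case: ifP.
have E0 : E 0.
  by exists finset.set0 => //; rewrite !big_set0 subrr normr0.
apply/andP; split; first by apply: ub_le_sup => //; exists eps.
by apply: ge_sup => //; exists 0.
Qed.

(** The bound is uniform in the query set; the empty query set, allowed by every budget, makes the
    supremum range over a nonempty set. *)
Lemma optimal_risk_le (R : realType) (q : R) n (V : finType) (Gamma : graph V)
    budget (eps : R) :
  \sum_(G : graph 'I_n) `|alt_pmf q Gamma G - null_pmf q G| <= eps ->
  `|1 - optimal_risk q n Gamma budget| <= eps.
Proof.
move=> l1; rewrite /optimal_risk; set E := image _ _.
have bnd Q := @dTV_transcript_le R n _ _ Q eps l1.
have ubE : ubound E eps by move=> _ [Q _ <-]; case/andP: (bnd Q).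
have [y Ey] : (E !=set0)%classic by eexists; exists finset.set0; rewrite //= cards0.
have y0 : 0 <= y by case: Ey => Q _ <-; case/andP: (bnd Q).
rewrite opprB addrC subrK ger0_norm; first by apply: ge_sup => //; exists y.
by apply: le_trans y0 _; apply: ub_le_sup => //; exists eps.
Qed.

Lemma exprD1_le (R : realType) (x e : R) k :
  0 <= x -> 0 < e -> k%:R * x <= e / (1 + e) -> (1 + x) ^+ k <= 1 + e.
Proof.
move=> x0 e0 kx.
have e1 : 0 < 1 + e by rewrite addr_gt0.
apply: (@le_trans _ _ (expR (k%:R * x))).
  by rewrite expRM_natl lerXn2r ?nnegrE ?expR_ge0 ?addr_ge0 // expR_ge1Dx.
(* Passing to inverses turns the upper bound on the exponential into
   [1 - k%:R * x <= expR (- (k%:R * x))], with [1 - e / (1 + e)] equal to the inverse of [1 + e]. *)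
rewrite -[expR _]invrK -expRN -[leRHS]invrK lef_pV2 ?posrE ?expR_gt0 ?invr_gt0 //.
apply: le_trans (expR_ge1Dx _); rewrite lerBrDr -lerBrDl.
by rewrite (le_trans kx) // le_eqVlt; apply/orP; left; apply/eqP; field; rewrite gt_eqF.
Qed.

(** * Asymptotics for trees of sublinear size *)

Local Open Scope classical_set_scope.

Theorem corollary5 (R : realType) (q : R) (hq0 : 0 < q) (hq1 : q < 1)
    (k : nat -> nat) (T : forall n : nat, graph 'I_(k n)) (D : nat)
    (hk : forall n : nat, (2 <= n)%N -> (2 <= k n <= n)%N)
    (htree : forall n : nat, (2 <= n)%N -> tree (T n))
    (hdeg : forall n : nat, (2 <= n)%N -> (max_degree (T n) <= D)%N)
    (hlittleo : (fun n : nat => (k n)%:R : R) =o_\oo (fun n : nat => n%:R : R)) :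
  weak_detection_impossible q T (fun n => 'C(n, 2)) /\
  (forall budget : nat -> nat, weak_detection_impossible q T budget).
Proof.
suff imp budget : weak_detection_impossible q T budget by split=> [|b]; exact: imp.
apply/cvgrPdist_le => eps eps0.
(* With [lam = q^-1], [rho] becomes [1 + c / (n - k n)]; [del] is the threshold of [exprD1_le] at
   [e = eps ^+ 2]. *)
pose c : R := (q^-1 - 1) * D%:R; pose del : R := eps ^+ 2 / (1 + eps ^+ 2).
have lam1 : 1 <= q^-1 by rewrite invf_ge1 // ltW.
have c0 : 0 <= c by rewrite mulr_ge0 // subr_ge0.
have e20 : 0 < eps ^+ 2 by rewrite exprn_gt0.
have del0 : 0 < del by rewrite divr_gt0 // addr_gt0.
(* This ratio serves twice: [(c + 2 * del) * k n <= del * n] gives both [k n < n] and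
   [c * k n <= del * (n - k n)]. *)
have eta0 : 0 < del / (c + 2 * del) by rewrite divr_gt0 //; lra.
have /eqoP/(_ _ eta0) small := hlittleo.
near=> n.
have n2 : (2 <= n)%N by near: n; exact: nbhs_infty_ge.
have n0 : 0 < n%:R :> R by rewrite ltr0n (leq_trans _ n2).
have kn : (c + 2 * del) * (k n)%:R <= del * n%:R.
  have : `|(k n)%:R : R| <= del / (c + 2 * del) * `|n%:R : R| by near: n; exact: small.
  rewrite !normr_nat mulrAC ler_pdivlMr; last by lra.
  by rewrite mulrC.
have k0 : 0 <= (k n)%:R :> R by [].
have ltkn : (k n < n)%N.
  rewrite -(ltr_nat R) -(ltr_pM2l del0); nra.
have nk0 : 0 < (n - k n)%:R :> R by rewrite ltr0n subn_gt0.
apply: optimal_risk_le; apply: l1_le_chi2 => //.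
- by move=> G; exact: null_pmf_gt0.
- exact: sum_null_pmf.
have cardk : #|'I_(k n)| = k n by rewrite card_ord.
have copies0 : 0 < #|copies n (T n)|%:R :> R.
  by rewrite ltr0n copies_neq0 // cardk ltnW.
rewrite alt_chi2 ?cardk ?(ltnW ltkn) // lerBlDl.
have [_ acT] := htree n n2.
have ovl S' := @copies_overlap n _ (T n) R q^-1 D S' lam1.
rewrite cardk in ovl.
apply: (@le_trans _ _ ((1 + c / (n - k n)%:R) ^+ k n)).
  (* For each fixed second copy, [copies_overlap] bounds the inner sum; summing over that copy
     cancels the squared number of copies. *)
  rewrite exprVn mulrC ler_pdivrMr ?exprn_gt0 //.
  apply: le_trans (ler_sum _ (fun S' HS' => ovl S' ltkn acT (hdeg n n2) HS')) _.
  by rewrite sumr_const -[leLHS]mulr_natl mulrA -expr2 mulrC /c -mulrA.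
apply: exprD1_le => //; first by rewrite divr_ge0.
rewrite -/del mulrA ler_pdivrMr // natrB ?(ltnW ltkn) //.
nra.
Unshelve. all: by end_near.
Qed.
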